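(* Let $f=(p,q):\overline{(U,E)}\to\overline{(V,E')}$ and $g=(r,t):\overline{(V,E')}\to\overline{(W,E'')}$ be two hesitant fuzzy soft mappings. Then: (i) if $f$ and $g$ are one-one, then so is $g\circ f$; (ii) if $f$ and $g$ are onto, then so is $g\circ f$; (iii) if $f$ and $g$ are both bijections, then so is $g\circ f$.
   Context: All universes ($U,V,W$) and attribute (parameter) sets ($E,E',E''$) are nonempty sets. A hesitant fuzzy element (HFE) is a nonempty subset of $[0,1]$. A hesitant fuzzy set on $U$ assigns to each $x\in U$ an HFE. A hesitant fuzzy soft set $F_A$ over $U$ with attributes from $E$ is given by a nonempty $A\subseteq E$ and, for each $e\in A$, a hesitant fuzzy set $F(e)$ on $U$; write $F_A(e)(x)$ for the HFE of $x\in U$ at $e$. By convention $F_A(e)(x)=\{0\}$ for $e\in E\setminus A$, and two hesitant fuzzy soft sets over $U$ with attributes from $E$ are equal when they agree as functions of $(e,x)\in E\times U$. The hesitant fuzzy soft class $\overline{(U,E)}$ is the collection of all hesitant fuzzy soft sets over $U$ with attributes from $E$. The union of HFEs is $\mu_1\cup\mu_2=\{\max(\gamma_1,\gamma_2):\gamma_1\in\mu_1,\gamma_2\in\mu_2\}$; for a nonempty family, $\bigcup_i\mu_i=\{\sup_i\gamma_i:\gamma_i\in\mu_i \text{ for all } i\}$ (so the maximum for finite families), and the union of the empty family is $\{0\}$. Given maps $p:U\to V$ and $q:E\to E'$, the hesitant fuzzy soft mapping $f=(p,q):\overline{(U,E)}\to\overline{(V,E')}$ sends $F_A$ to its image $f(F_A)$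 defined, for $\beta\in E'$ and $y\in V$, by $f(F_A)(\beta)(y)=\bigcup_{\alpha\in q^{-1}(\beta)\cap A,\ s\in p^{-1}(y)}F_A(\alpha)(s)$. The mapping $f=(p,q)$ is one-one if both $p$ and $q$ are one-one, onto if both $p$ and $q$ are onto, and a bijection if it is both one-one and onto. The composite $g\circ f$ of $f=(p,q)$ and $g=(r,t)$ is the hesitant fuzzy soft mapping $\overline{(U,E)}\to\overline{(W,E'')}$ satisfying $(g\circ f)(F_A)=g(f(F_A))$ for every $F_A\in\overline{(U,E)}$; its underlying pair of maps is $(r\circ p,\,t\circ q)$. *)

(* Defs.v *)
From mathcomp Require Import all_boot all_order all_algebra.
From mathcomp Require Import boolp classical_sets functions reals.
Set Implicit Arguments.
Unset Strict Implicit.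
Unset Printing Implicit Defensive.
Import Order.TTheory GRing.Theory Num.Theory.
Local Open Scope classical_set_scope.
Local Open Scope ring_scope.

Record hfe (R : realType) := Hfe {
  hfe_set :> set R;
  hfe_nonempty : hfe_set !=set0;
  hfe_unit : hfe_set `<=` [set c | 0 <= c <= 1] }.

(* [F_A] together with its extension by [{0}] to the attributes outside [A]. *)
Record hfss (R : realType) (U E : Type) := Hfss {
  hfss_attr : set E;
  hfss_val :> E -> U -> hfe R;
  hfss_attr_nonempty : hfss_attr !=set0;
  hfss_val_out : forall e x,
    ~ hfss_attr e -> hfss_val e x = [set 0] :> set R }.

(* Equality in the hesitant fuzzy soft class: the attribute set [A] itself is
   not compared, only the function of [(e, x)]. *)
Definition hfss_eq (R : realType) (U E : Type) (F G : hfss R U E) : Prop :=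
  forall e x, F e x = G e x :> set R.

Definition hfe_bigcup_set (R : realType) (I : Type) (D : set I)
    (mu : I -> hfe R) : set R :=
  if `[< D = set0 >] then [set 0]
  else [set sup (gamma @` D) | gamma in
         [set gamma : I -> R | forall i, D i -> hfe_set (mu i) (gamma i)]].

Section Bigcup.
Variables (R : realType).
Implicit Types (I J : Type).

Lemma hfe_le1 (m : hfe R) c : hfe_set m c -> c <= 1.
Proof. by move=> /hfe_unit /= /andP[]. Qed.

Lemma sup_image_le I (D : set I) (g : I -> R) c :
  0 <= c -> (forall i, D i -> g i <= c) -> sup (g @` D) <= c.
Proof.
move=> c0 gc; have [->|/set0P[i Di]] := eqVneq D set0.
  by rewrite image_set0 sup0.
apply: ge_sup; first by exists (g i), i.
by move=> _ [j Dj <-]; exact: gc.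
Qed.

Lemma sup_image_ge I (D : set I) (g : I -> R) i :
  (forall i, D i -> g i <= 1) -> D i -> g i <= sup (g @` D).
Proof.
move=> g1 Di; apply: ub_le_sup; last by exists i.
by exists 1 => _ [j Dj <-]; exact: g1.
Qed.

Lemma sup_image_ge0 I (D : set I) (g : I -> R) :
  (forall i, D i -> 0 <= g i <= 1) -> 0 <= sup (g @` D).
Proof.
move=> g01; have [->|/set0P[i Di]] := eqVneq D set0.
  by rewrite image_set0 sup0.
have /andP[gi0 _] := g01 _ Di; apply: (le_trans gi0).
by apply: sup_image_ge => // j /g01 /andP[].
Qed.

Lemma hfe_choice I (mu : I -> hfe R) :
  exists gamma : I -> R, forall i, hfe_set (mu i) (gamma i).
Proof.
by have [h hP] := choice (fun i => hfe_nonempty (mu i)); exists h.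
Qed.

Lemma hfe_bigcup_setE I (D : set I) (mu : I -> hfe R) :
  hfe_bigcup_set D mu = [set sup (gamma @` D) | gamma in
         [set gamma : I -> R | forall i, D i -> hfe_set (mu i) (gamma i)]].
Proof.
rewrite /hfe_bigcup_set; case: asboolP => // ->; apply/seteqP; split=> c /=.
  move=> ->; have [g gP] := hfe_choice mu.
  by exists g => //; rewrite image_set0 sup0.
by move=> [g _ <-]; rewrite image_set0 sup0.
Qed.

Lemma hfe_bigcup_nonempty I (D : set I) (mu : I -> hfe R) :
  hfe_bigcup_set D mu !=set0.
Proof.
rewrite hfe_bigcup_setE; have [g gP] := hfe_choice mu.
by exists (sup (g @` D)), g => // i _; exact: gP.
Qed.

Lemma hfe_bigcup_unit I (D : set I) (mu : I -> hfe R) :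
  hfe_bigcup_set D mu `<=` [set c | 0 <= c <= 1].
Proof.
rewrite hfe_bigcup_setE => _ [g gP <-] /=; apply/andP; split.
  by apply: sup_image_ge0 => i /gP /hfe_unit.
by apply: sup_image_le => // i /gP /hfe_le1.
Qed.

End Bigcup.

Definition hfe_bigcup (R : realType) (I : Type) (D : set I)
    (mu : I -> hfe R) : hfe R :=
  Hfe (hfe_bigcup_nonempty D mu) (hfe_bigcup_unit (mu := mu)).

Section Image.
Variables (R : realType) (U V E E' : Type) (p : U -> V) (q : E -> E').
Variable F : hfss R U E.

Definition hfss_image_val (b : E') (y : V) : hfe R :=
  hfe_bigcup ((q @^-1` [set b] `&` hfss_attr F) `*` (p @^-1` [set y]))
             (fun i => F i.1 i.2).

Lemma hfss_image_attr_nonempty : q @` hfss_attr F !=set0.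
Proof. by have [e Ae] := hfss_attr_nonempty F; exists (q e), e. Qed.

Lemma hfss_image_val_out b y :
  ~ (q @` hfss_attr F) b -> hfss_image_val b y = [set 0] :> set R.
Proof.
move=> nb; rewrite /= /hfe_bigcup_set; case: asboolP => // -[].
apply/seteqP; split=> // -[e x] /= [[qe Ae] _].
by apply: nb; exists e.
Qed.

(* Any attribute set containing [q @` A] would give an equal soft set, in the
   sense of [hfss_eq]. *)
Definition hfss_image : hfss R V E' :=
  Hfss hfss_image_attr_nonempty hfss_image_val_out.

End Image.

(* A hesitant fuzzy soft mapping: a function between the soft classes that is
   induced by its underlying pair [(p, q)] of maps. *)
Record hfs_mapping (R : realType) (U V E E' : Type) := HfsMapping {
  hfs_fun :> hfss R U E -> hfss R V E';
  hfs_univ : U -> V;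
  hfs_attr : E -> E';
  hfs_funE : forall F, hfss_eq (hfs_fun F) (hfss_image hfs_univ hfs_attr F) }.

Definition hfs_of_pair (R : realType) (U V E E' : Type)
    (p : U -> V) (q : E -> E') : hfs_mapping R U V E E' :=
  @HfsMapping R U V E E' (hfss_image p q) p q (fun _ _ _ => erefl).

Definition hfs_one_one (R : realType) (U V E E' : Type)
    (f : hfs_mapping R U V E E') : Prop :=
  injective (hfs_univ f) /\ injective (hfs_attr f).

Definition hfs_onto (R : realType) (U V E E' : Type)
    (f : hfs_mapping R U V E E') : Prop :=
  set_surj [set: U] [set: V] (hfs_univ f) /\
  set_surj [set: E] [set: E'] (hfs_attr f).

Definition hfs_bijection (R : realType) (U V E E' : Type)
    (f : hfs_mapping R U V E E') : Prop :=
  hfs_one_one f /\ hfs_onto f.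

Section Composition.
Variable R : realType.

Lemma eq_hfe_bigcup (I : Type) (D : set I) (mu nu : I -> hfe R) :
  (forall i, D i -> mu i = nu i :> set R) ->
  hfe_bigcup D mu = hfe_bigcup D nu :> set R.
Proof.
move=> mn; rewrite /= !hfe_bigcup_setE; apply/seteqP.
by split=> _ [g gP <-]; exists g => // i Di; have := gP i Di; rewrite mn.
Qed.

Lemma hfe_bigcup_zeros (I : Type) (D D' : set I) (mu : I -> hfe R) :
  D `<=` D' -> (forall i, D' i -> ~ D i -> mu i = [set 0] :> set R) ->
  hfe_bigcup D mu = hfe_bigcup D' mu :> set R.
Proof.
move=> DD' mu0.
have sub (g : I -> R) : (forall i, D' i -> hfe_set (mu i) (g i)) ->
    sup (g @` D') = sup (g @` D).
  move=> gP; have g01 i : D' i -> 0 <= g i <= 1 by move/gP/hfe_unit.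
  have gD i : D i -> 0 <= g i <= 1 by move/DD'/g01.
  have g1 i : D' i -> g i <= 1 by move=> /g01 /andP[].
  apply/le_anti/andP; split; apply: sup_image_le.
  - exact: sup_image_ge0.
  - move=> i D'i; have [Di|nDi] := pselect (D i).
      by apply: sup_image_ge => // j /DD'/g1.
    have := gP i D'i; rewrite mu0 // => ->; exact: sup_image_ge0.
  - exact: sup_image_ge0.
  - by move=> i /DD'; exact: sup_image_ge.
rewrite /= !hfe_bigcup_setE; apply/seteqP; split=> _ [g gP <-]; last first.
  by exists g; rewrite ?sub //= => i /DD'; exact: gP.
pose h i := if `[< D i >] then g i else 0.
have hP i : D' i -> hfe_set (mu i) (h i).
  by move=> D'i; rewrite /h; case: asboolP => [/gP//|/mu0 ->].
exists h => //; rewrite sub //; congr sup; apply/seteqP.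
by split=> _ [i Di <-]; exists i => //; rewrite /h asboolT.
Qed.

Lemma hfe_bigcup_fibers (I J : Type) (k : I -> J) (D : set J)
    (mu : I -> hfe R) :
  hfe_bigcup D (fun j => hfe_bigcup (k @^-1` [set j]) mu) =
  hfe_bigcup (k @^-1` D) mu :> set R.
Proof.
have key (g : I -> R) (s : J -> R) :
    (forall i, D (k i) -> hfe_set (mu i) (g i)) ->
    (forall j, D j -> s j = sup (g @` (k @^-1` [set j]))) ->
    sup (s @` D) = sup (g @` (k @^-1` D)).
  move=> gP sE; have g01 i : D (k i) -> 0 <= g i <= 1 by move/gP/hfe_unit.
  have fib j i : D j -> k i = j -> 0 <= g i <= 1 by move=> Dj ki; apply: g01; rewrite ki.
  have fib1 j i : D j -> k i = j -> g i <= 1 by move=> Dj ki; have /andP[] := fib _ _ Dj ki.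
  have s01 j : D j -> 0 <= s j <= 1.
    move=> Dj; rewrite sE //; apply/andP; split.
      by apply: sup_image_ge0 => i /= ki; exact: fib ki.
    by apply: sup_image_le => // i /= ki; exact: fib1 ki.
  have g1 i : D (k i) -> g i <= 1 by move=> /g01/andP[].
  apply/le_anti/andP; split; apply: sup_image_le.
  - exact: sup_image_ge0.
  - move=> j Dj; rewrite sE //; apply: sup_image_le; first exact: sup_image_ge0.
    by move=> i /= ki; apply: sup_image_ge => //=; rewrite ki.
  - exact: sup_image_ge0.
  - move=> i /= Di; apply: (@le_trans _ _ (s (k i))).
      by rewrite sE //; apply: sup_image_ge => // l /= kl; exact: fib1 kl.
    by apply: sup_image_ge => // j /s01 /andP[].
rewrite /= !hfe_bigcup_setE; apply/seteqP; split=> _ [s sP <-].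
  have /choice[h hP] : forall j, exists g : I -> R, D j ->
      (forall i, k i = j -> hfe_set (mu i) (g i)) /\ s j = sup (g @` (k @^-1` [set j])).
    move=> j; have [Dj|nDj] := pselect (D j); last by exists (fun=> 0).
    have := sP j Dj; rewrite /= hfe_bigcup_setE => -[g gP gs].
    by exists g => _; split.
  exists (fun i => h (k i) i) => [i /= Di|]; first exact: (hP _ Di).1.
  apply/esym/key => [i Di|j Dj]; first exact: (hP _ Di).1.
  rewrite (hP j Dj).2; congr sup; apply/seteqP.
  by split=> _ [i /= ki <-]; exists i => //; rewrite ki.
exists (fun j => sup (s @` (k @^-1` [set j]))) => [j /= Dj|]; last exact: key.
by rewrite hfe_bigcup_setE; exists s => // i /= ki; apply: sP; rewrite /= ki.
Qed.

Lemma hfss_imageE (U V E E' : Type) (p : U -> V) (q : E -> E')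
    (F : hfss R U E) b y :
  hfss_image p q F b y =
  hfe_bigcup ((fun i => (q i.1, p i.2)) @^-1` [set (b, y)])
             (fun i => F i.1 i.2) :> set R.
Proof.
apply: hfe_bigcup_zeros => [[e x] /= [[<- _] <-] //|[e x] /= [qe px] nA].
by apply: hfss_val_out => Ae; apply: nA; split.
Qed.

Lemma hfss_image_eq (U V E E' : Type) (p : U -> V) (q : E -> E')
    (F G : hfss R U E) :
  hfss_eq F G -> hfss_eq (hfss_image p q F) (hfss_image p q G).
Proof.
by move=> FG b y; rewrite !hfss_imageE; apply: eq_hfe_bigcup => i _; exact: FG.
Qed.

Variables (U V W E E' E'' : Type).
Variables (g : hfs_mapping R V W E' E'') (f : hfs_mapping R U V E E').

Lemma hfs_comp_funE F :
  hfss_eq ((g \o f) F)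
    (hfss_image (hfs_univ g \o hfs_univ f) (hfs_attr g \o hfs_attr f) F).
Proof.
move=> c z; rewrite /comp hfs_funE (hfss_image_eq _ _ (@hfs_funE _ _ _ _ _ f F)).
rewrite !hfss_imageE; set k := fun i : E * U => (hfs_attr f i.1, hfs_univ f i.2).
transitivity (hfe_bigcup
    ((fun j => (hfs_attr g j.1, hfs_univ g j.2)) @^-1` [set (c, z)])
    (fun j => hfe_bigcup (k @^-1` [set j]) (fun i => F i.1 i.2)) : set R).
  by apply: eq_hfe_bigcup => -[b y] _; exact: hfss_imageE.
by rewrite hfe_bigcup_fibers.
Qed.

(* The function between classes is literally [g \o f]; [hfs_comp_funE] says
   that it is induced by the composed pair. *)
Definition hfs_comp : hfs_mapping R U W E E'' := HfsMapping hfs_comp_funE.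

End Composition.

(* Main.v *)
Require Import Defs.
From mathcomp Require Import all_boot all_order all_algebra.
From mathcomp Require Import boolp classical_sets functions reals.

(** The three properties of a hesitant fuzzy soft mapping constrain only its
    underlying pair of maps, and the pair underlying [hfs_comp g f] is, by
    computation, the componentwise composite of the pairs underlying [g] and
    [f].  The theorem is therefore the stability under composition of
    injectivity and surjectivity of plain functions, used once on the
    universes and once on the attributes. *)

Lemma hfs_one_one_comp (R : realType) (U V W E E' E'' : Type)
    (f : hfs_mapping R U V E E') (g : hfs_mapping R V W E' E'') :
  hfs_one_one f -> hfs_one_one g -> hfs_one_one (hfs_comp g f).
Proof. by move=> [pI qI] [rI tI]; split; apply: inj_comp. Qed.

Lemma hfs_onto_comp (R : realType) (U V W E E' E'' : Type)
    (f : hfs_mapping R U V E E') (g : hfs_mapping R V W E' E'') :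
  hfs_onto f -> hfs_onto g -> hfs_onto (hfs_comp g f).
Proof.
by move=> [pS qS] [rS tS]; split; [exact: surj_comp pS rS|exact: surj_comp qS tS].
Qed.

Theorem theorem3p11 (R : realType) (U V W E E' E'' : Type)
    (hU : inhabited U) (hV : inhabited V) (hW : inhabited W)
    (hE : inhabited E) (hE' : inhabited E') (hE'' : inhabited E'')
    (f : hfs_mapping R U V E E') (g : hfs_mapping R V W E' E'') :
  (hfs_one_one f -> hfs_one_one g -> hfs_one_one (hfs_comp g f)) /\
  (hfs_onto f -> hfs_onto g -> hfs_onto (hfs_comp g f)) /\
  (hfs_bijection f -> hfs_bijection g -> hfs_bijection (hfs_comp g f)).
Proof.
split; first exact: hfs_one_one_comp.
split; first exact: hfs_onto_comp.
move=> [f11 fO] [g11 gO].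
by split; [exact: hfs_one_one_comp|exact: hfs_onto_comp].
Qed.
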